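(* Suppose $\pi$ is a QSD of $(X_t)_{0\le t<\tau_\partial}$ with $\pi\in\mathcal P_\infty(\Lambda)$, and that the adjoint Dobrushin condition (AD) holds with function $\psi$, time $t_0$, constant $c_0'>0$ and probability measure $\nu'$. Then $\nu'\ll\Lambda$, $\nu'(\frac{d\pi}{d\Lambda})>0$, and $(X_t)$ and $\pi$ satisfy the reverse Dobrushin condition (RD) with the same time $t_0$, the constant $$c_0:=\frac{c_0'\,\nu'(\frac{d\pi}{d\Lambda})}{\|\psi\|_\infty\|1/\psi\|_\infty\|\frac{d\pi}{d\Lambda}\|_{L^\infty(\Lambda)}}\in(0,1],$$ and the probability measure $\nu:=\frac{\frac{d\pi}{d\Lambda}\nu'}{\nu'(\frac{d\pi}{d\Lambda})}$.
   Context: $\chi$ is a metric space with Borel $\sigma$-algebra, equipped with a distinguished $\sigma$-finite Borel measure $\Lambda$ of full support. $(X_t)_{0\le t<\tau_\partial}$ is a killed Markov process on $\chi$ (discrete or continuous time) with absorption time $\tau_\partial$, submarkovian semigroup $P_t(x,A)=\mathbb P_x(X_t\in A,\tau_\partial>t)$; $K1(x)=K(x,\chi)$. A QSD is a probability measure $\pi$ with $\mathbb P_\pi(X_t\in\cdot\mid\tau_\partial>t)=\pi$ for all $t$. $\mathcal P_\infty(\Lambda)$ = probability measures $\ll\Lambda$ with density in $L^\infty(\Lambda)$; for a measure $m$ and function $f$, $fm$ denotes the measure $f\,dm$. $\mathcal B_{b,\gg}(\chi)$ = bounded Borel functions with strictly positive infimum. (AD) Adjoint Dobrushin condition: there exist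 $\psi\in\mathcal B_{b,\gg}(\chi)$, $t_0>0$, $a>0$ and a submarkovian kernel $\tilde P$ with $\psi(x)\Lambda(dx)P_{t_0}(x,dy)=a\psi(y)\Lambda(dy)\tilde P(y,dx)$ as measures on $\chi\times\chi$, $\tilde P1(y)>0$ for $\Lambda$-a.e. $y$, and there exist $c_0'>0$ and $\nu'\in\mathcal P(\chi)$, not mutually singular with $\pi$, such that $\tilde P(y,\cdot)/\tilde P1(y)\ge c_0'\nu'(\cdot)$ for $\Lambda$-a.e. $y$. (RD): there exist $t_0>0$ and a submarkovian kernel $R$ with $\pi(dx)P_{t_0}(x,dy)=\pi(dy)R(y,dx)$, and $c_0>0$, $\nu\in\mathcal P(\chi)$ with $R(y,\cdot)/R1(y)\ge c_0\nu$ for $\pi$-a.e. $y$. *)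

(* Defs.v *)
From HB Require Import structures.
From mathcomp Require Import all_boot all_order all_algebra.
From mathcomp Require Import all_classical all_reals all_analysis.
From mathcomp Require Import kernel ess_sup_inf.
Set Implicit Arguments. Unset Strict Implicit. Unset Printing Implicit Defensive.
Import Order.TTheory GRing.Theory Num.Theory.
Import numFieldNormedType.Exports.
Local Open Scope classical_set_scope.
Local Open Scope ring_scope.

(* The state space chi: a measurable type whose sigma-algebra is the Borel
   sigma-algebra of a metric [dist] on it. *)
Definition is_metric (R : realType) (T : Type) (dist : T -> T -> R) :=
  [/\ (forall x y, dist x y = 0 <-> x = y),
      (forall x y, dist x y = dist y x) &
      (forall x y z, dist x z <= dist x y + dist y z)].

Definition dopen (R : realType) (T : Type) (dist : T -> T -> R) (U : set T) :=
  forall x, U x -> exists2 r : R, 0 < r & [set y | dist x y < r] `<=` U.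

Definition borel_for (R : realType) d (T : measurableType d)
  (dist : T -> T -> R) := (@measurable d T) = <<s dopen dist >>.

Definition full_support (R : realType) d (T : measurableType d)
  (dist : T -> T -> R) (L : {measure set T -> \bar R}) :=
  forall U, dopen dist U -> U !=set0 -> (0 < L U)%E.

Definition Bb_pos (R : realType) d (T : measurableType d) (psi : T -> R) :=
  [/\ measurable_fun setT psi, (exists M : R, forall x, psi x <= M) &
      (exists2 m : R, 0 < m & forall x, m <= psi x)].

Definition supnorm (R : realType) (T : Type) (g : T -> R) : R :=
  sup [set `|g x| | x in [set: T]].

Definition is_density (R : realType) d (T : measurableType d)
  (L : {measure set T -> \bar R}) (p : set T -> \bar R) (f : T -> R) :=
  [/\ measurable_fun setT f, (forall x, 0 <= f x) &
      forall A, measurable A -> p A = (\int[L]_(x in A) (f x)%:E)%E].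

(* The measure  m(dx) K(x,dy)  on chi x chi, evaluated on a measurable E,
   weighted by g(x):  E |-> \int g(x) \int 1_E(x,y) K(x,dy) m(dx). *)
Definition joint_fwd (R : realType) d (T : measurableType d)
  (m : {measure set T -> \bar R}) (g : T -> R) (K : R.-spker T ~> T)
  (E : set (T * T)) : \bar R :=
  (\int[m]_x ((g x)%:E * \int[K x]_y (\1_E (x, y))%:E))%E.

(* The measure  m(dy) K(y,dx)  on chi x chi (first coordinate x, second y),
   weighted by g(y). *)
Definition joint_bwd (R : realType) d (T : measurableType d)
  (m : {measure set T -> \bar R}) (g : T -> R) (K : R.-spker T ~> T)
  (E : set (T * T)) : \bar R :=
  (\int[m]_y ((g y)%:E * \int[K y]_x (\1_E (x, y))%:E))%E.

(* pi is a quasi-stationary distribution for the submarkovian semigroup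
   (P t)_{t in Tm}:  P_pi(X_t in A | tau > t) = pi(A). *)
Definition is_QSD (R : realType) d (T : measurableType d) (Tm : set R)
  (P : R -> R.-spker T ~> T) (pi : probability T R) :=
  forall t, Tm t ->
    (0 < \int[pi]_x P t x setT)%E /\
    forall A, measurable A ->
      ((\int[pi]_x P t x A) / (\int[pi]_x P t x setT))%E = pi A.

Definition mutually_singular (R : realType) d (T : measurableType d)
  (m1 m2 : set T -> \bar R) :=
  exists A, [/\ measurable A, m1 A = 0%E & m2 (~` A) = 0%E].

(* Main.v *)
(** Weighting the adjoint relation [psi(x) L(dx) K(x,dy) = a psi(y) L(dy) Kt(y,dx)]
    by [q = f / psi] gives [pi(dx) K(x,dy) = a psi(y) q(x) L(dy) Kt(y,dx)].  Since [pi]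
    is quasi-stationary, the second marginal of the left-hand side is [lam pi], so
    [a psi(y) Kt(y, q) = lam f(y)] for almost every [y], and
    [Rk(y,dx) = (a psi(y) / f(y)) q(x) Kt(y,dx)] is a reversed kernel of mass [lam].
    The quotient [Rk(y,A) / Rk(y,T) = Kt(y, q 1_A) / Kt(y, q)] is bounded below through
    [f / |psi| <= q <= |1/psi| M] and the minorization of [Kt], where [M] bounds [f]
    [Kt(y,.)]-almost surely because [Kt(y,.)] does not charge a given [L]-null set,
    for almost every [y].  The same fact gives [nu' << L]. *)
Require Import Defs.
From HB Require Import structures.
From mathcomp Require Import all_boot all_order all_algebra.
From mathcomp Require Import all_classical all_reals all_analysis.
From mathcomp Require Import kernel ess_sup_inf.
From mathcomp Require Import measurable_realfun ring.
Import Order.TTheory GRing.Theory Num.Theory.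
Import numFieldNormedType.Exports.
Local Open Scope classical_set_scope.
Local Open Scope ring_scope.
Set Implicit Arguments. Unset Strict Implicit. Unset Printing Implicit Defensive.

(** * Functionals determined by their values on indicators *)

Section integral_like.
Local Open Scope ereal_scope.
Context (R : realType) d (X : measurableType d).

(** Homogeneity, additivity and monotone convergence are asked of an arbitrary functional, so that
    iterated integrals against kernels qualify without a measure being built on the product. *)
Definition integral_like (I : (X -> \bar R) -> \bar R) :=
  [/\ (forall (r : R) (h : X -> \bar R), (0 <= r)%R -> measurable_fun setT h ->
         (forall x, 0 <= h x) -> I (fun x => r%:E * h x) = r%:E * I h),
      (forall h1 h2 : X -> \bar R, measurable_fun setT h1 -> (forall x, 0 <= h1 x) ->
         measurable_fun setT h2 -> (forall x, 0 <= h2 x) ->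
         I (fun x => h1 x + h2 x) = I h1 + I h2) &
      (forall g : nat -> X -> \bar R,
         (forall n, measurable_fun setT (g n)) -> (forall n x, 0 <= g n x) ->
         (forall x, nondecreasing_seq (g ^~ x)) ->
         I (fun x => limn (g ^~ x)) = limn (fun n => I (g n)))].

Import HBNNSimple.

(** Linearity carries the agreement from indicators to nonnegative simple functions, and increasing
    limits of these reach every [h]. *)
Lemma integral_like_unique I J : integral_like I -> integral_like J ->
  (forall A, measurable A ->
     I (fun x => (\1_A x)%:E) = J (fun x => (\1_A x)%:E)) ->
  forall h, measurable_fun setT h -> (forall x, 0 <= h x) -> I h = J h.
Proof.
move=> [IZ ID Ilim] [JZ JD Jlim] IJ h mh h0.
have simple (s : seq R) (A : R -> set X) :
    (forall r, measurable (A r)) -> (forall r, r \in s -> (0 <= r)%R) ->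
    I (fun x => \sum_(r <- s) r%:E * (\1_(A r) x)%:E) =
    J (fun x => \sum_(r <- s) r%:E * (\1_(A r) x)%:E).
  move=> mA; have mI r : measurable_fun setT (fun x => (\1_(A r) x)%:E : \bar R).
    exact/measurable_EFinP.
  elim: s => [_|r s ih s0].
    (* No clause gives the value at the zero function, so the empty sum is written as 0 times an
       indicator. *)
    have -> : (fun x => \sum_(r <- [::]) r%:E * (\1_(A r) x)%:E) =
        (fun x => 0%:E * (\1_(A 0%R) x)%:E :> \bar R).
      by apply/funext => x; rewrite big_nil mul0e.
    by rewrite IZ// ?JZ ?IJ// => x; rewrite lee_fin.
  have r0 : (0 <= r)%R by apply: s0; rewrite mem_head.
  have s0' r' : r' \in s -> (0 <= r')%R by move=> r's; apply: s0; rewrite in_cons r's orbT.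
  under eq_fun do rewrite big_cons.
  have m1 : measurable_fun setT (fun x => r%:E * (\1_(A r) x)%:E : \bar R).
    exact: measurable_funeM.
  have p1 x : 0 <= r%:E * (\1_(A r) x)%:E :> \bar R by rewrite mule_ge0 ?lee_fin.
  have m2 : measurable_fun setT (fun x => \sum_(r <- s) r%:E * (\1_(A r) x)%:E : \bar R).
    by apply: emeasurable_sum => r' ; exact: measurable_funeM.
  have p2 x : 0 <= \sum_(r <- s) r%:E * (\1_(A r) x)%:E :> \bar R.
    by rewrite big_seq; apply: sume_ge0 => r' /s0' ?; rewrite mule_ge0 ?lee_fin.
  by rewrite ID// JD// ih// IZ ?JZ ?IJ// => x; rewrite lee_fin.
pose g_ := nnsfun_approx measurableT mh.
have hE : h = (fun x => limn ((fun n => EFin \o g_ n) ^~ x)).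
  apply/funext => x; apply/esym/cvg_lim => //.
  by apply: cvg_nnsfun_approx => //.
have mg n : measurable_fun setT (EFin \o g_ n) by exact/measurable_EFinP.
have g0 n x : 0 <= (EFin \o g_ n) x by rewrite lee_fin.
have ndg x : nondecreasing_seq (fun n => (EFin \o g_ n) x).
  by move=> m n mn /=; rewrite lee_fin; exact/lefP/nd_nnsfun_approx.
rewrite hE (Ilim (fun n => EFin \o g_ n))// (Jlim (fun n => EFin \o g_ n))//.
congr (limn _); apply/funext => n.
have -> : EFin \o g_ n = fun x =>
    \sum_(r <- finmap.enum_fset (fset_set (range (g_ n)))) r%:E * (\1_(g_ n @^-1` [set r]) x)%:E.
  apply/funext => x; rewrite /= fimfunE fsbig_finite//= -sumEFin.
  by apply: eq_bigr => r _; rewrite EFinM.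
apply: simple => // r; rewrite in_fset_set// inE => -[x _ <-].
by [].
Qed.

Lemma integral_like_integral (mu : {measure set X -> \bar R}) :
  integral_like (fun h => \int[mu]_x h x).
Proof.
split => [r h r0 mh h0|h1 h2 *|g mg g0 ndg].
- by rewrite ge0_integralZl.
- by rewrite ge0_integralD.
- rewrite monotone_convergence// => x _; exact: ndg.
Qed.

End integral_like.

(** * Iterated integrals against a weighted kernel *)

Section weighted_kernel.
Local Open Scope ereal_scope.
Context (R : realType) d d' d3 (X : measurableType d) (Y : measurableType d')
  (Z : measurableType d3).
Variables (m : {measure set X -> \bar R}) (g : X -> R) (K : R.-sfker X ~> Y)
  (phi : X * Y -> Z).
Hypotheses (mg : measurable_fun setT g) (g0 : forall x, (0 <= g x)%R)
  (mphi : measurable_fun setT phi).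

(** Each property is applied twice, to the inner and to the outer integral. The map [phi] will be
    the identity for [joint_fwd], the swap for [joint_bwd], and the second projection for
    integration against a density. *)
Lemma integral_like_weighted_kernel :
  integral_like (fun h : Z -> \bar R =>
    \int[m]_x ((g x)%:E * \int[K x]_y h (phi (x, y)))).
Proof.
have mh (h : Z -> \bar R) x : measurable_fun setT h -> measurable_fun setT (fun y => h (phi (x, y))).
  by move=> mh; apply: (@measurable_fun_pair2 _ _ _ _ _ _ (h \o phi) x); exact: measurableT_comp.
have mK (h : Z -> \bar R) : measurable_fun setT h -> (forall z, 0 <= h z) ->
    measurable_fun setT (fun x => \int[K x]_y h (phi (x, y))).
  move=> mh' h0; apply: (measurable_fun_integral_sfinite_kernel (h \o phi)) => [t/=|].
    exact: h0.
  exact: measurableT_comp.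
have mgK (h : Z -> \bar R) : measurable_fun setT h -> (forall z, 0 <= h z) ->
    measurable_fun setT (fun x => (g x)%:E * \int[K x]_y h (phi (x, y))).
  move=> *; apply: emeasurable_funM; [exact/measurable_EFinP|exact: mK].
have gK0 (h : Z -> \bar R) x : (forall z, 0 <= h z) -> 0 <= (g x)%:E * \int[K x]_y h (phi (x, y)).
  by move=> h0; rewrite mule_ge0 ?lee_fin// integral_ge0.
split => [r h r0 mh' h0|h1 h2 mh1 h10 mh2 h20|u mu u0 ndu].
- rewrite -ge0_integralZl//; last 2 first.
  + exact: mgK.
  + by move=> x _; exact: gK0.
  apply: eq_integral => x _; rewrite muleCA ge0_integralZl//.
  exact: mh.
- rewrite -ge0_integralD//; last 4 first.
  + by move=> x _; exact: gK0.
  + exact: mgK.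
  + by move=> x _; exact: gK0.
  + exact: mgK.
  apply: eq_integral => x _; rewrite ge0_integralD//; last 2 first.
  + exact: mh.
  + exact: mh.
  by rewrite ge0_muleDr// integral_ge0.
- rewrite -monotone_convergence//; last 3 first.
  + by move=> n; exact: mgK.
  + by move=> n x _; exact: gK0.
  + move=> x _ p q pq; rewrite lee_wpmul2l ?lee_fin//.
    apply: ge0_le_integral => //; [exact: mh|exact: mh|].
    by move=> y _; exact: ndu.
  apply: eq_integral => x _; rewrite monotone_convergence//; last by move=> n; exact: mh.
  rewrite [RHS]limeMl//; apply: ereal_nondecreasing_is_cvgn => p q pq.
  apply: ge0_le_integral => //; [exact: mh|exact: mh|].
  by move=> y _; exact: ndu.
Qed.

End weighted_kernel.

(** * Densities, null sets, and the adjoint relation for general integrands *)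

Lemma measurable_fun_ge0_inv (R : realType) d (X : measurableType d) (f : X -> R) :
  (forall x, 0 <= f x) -> measurable_fun setT f ->
  measurable_fun setT (fun x => (f x)^-1).
Proof.
(* The inverse is the power -1 also at 0, where both are 0. *)
move=> f0 mf; under eq_fun do rewrite -powR_inv1//.
exact: (measurableT_comp (measurable_powR _)).
Qed.

Lemma integral_indicE (R : realType) d (X : measurableType d)
    (mu : {measure set X -> \bar R}) (A : set X) (h : X -> \bar R) :
  (\int[mu]_(x in A) h x = \int[mu]_x ((\1_A x)%:E * h x))%E.
Proof.
by rewrite integral_mkcond epatch_indic; apply: eq_integral => x _; rewrite muleC.
Qed.

Lemma ge0_integral0_ae (R : realType) d (X : measurableType d)
    (mu : {measure set X -> \bar R}) (h : X -> \bar R) :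
  measurable_fun setT h -> (forall x, 0 <= h x)%E -> (\int[mu]_x h x = 0)%E ->
  {ae mu, forall x, h x = 0%E}.
Proof.
move=> mh h0 ih; have : ae_eq mu setT h (cst 0%E).
  apply/ae_eq_integral_abs => //; rewrite -[RHS]ih.
  by apply: eq_integral => x _; rewrite gee0_abs.
by apply: filterS => x; exact.
Qed.

Lemma null_dominates_ae (R : realType) d (X : measurableType d)
    (mu nu : {measure set X -> \bar R}) (Q : X -> Prop) :
  nu `<< mu -> {ae mu, forall x, Q x} -> {ae nu, forall x, Q x}.
Proof.
move=> /null_content_dominatesP numu [N [mN N0 QN]]; exists N; split => //.
exact: numu.
Qed.

Lemma integral_density (R : realType) d (X : measurableType d)
    (mu p : {measure set X -> \bar R}) (f : X -> R) (h : X -> \bar R) :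
  is_density mu p f -> measurable_fun setT h -> (forall x, 0 <= h x)%E ->
  (\int[p]_x h x = \int[mu]_x ((f x)%:E * h x))%E.
Proof.
move=> [mf f0 pf] mh h0.
(* The right-hand side is a weighted kernel integral for the Dirac kernel. *)
pose D := kdirac (@measurable_id _ X setT) : R.-sfker X ~> X.
have DE (u : X -> \bar R) x : measurable_fun setT u ->
    (\int[D x]_y u ((x, y).2) = u x)%E.
  by move=> mu'; rewrite integral_dirac// diracT mul1e.
transitivity (\int[mu]_x ((f x)%:E * \int[D x]_y h ((x, y).2)))%E; last first.
  by apply: eq_integral => x _; rewrite DE.
apply: (integral_like_unique (integral_like_integral p)
  (integral_like_weighted_kernel mu D mf f0 (@measurable_snd _ _ X X))) => //.
move=> A mA; rewrite integral_indic// setIT pf// integral_indicE.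
apply: eq_integral => x _; rewrite (DE (fun z => (\1_A z)%:E)) 1?muleC//.
exact/measurable_EFinP.
Qed.

(** Both sides are integral-like in [h] and agree on indicators by hypothesis; the constant [a] is
    absorbed into the backward weight. *)
Lemma joint_integral_eq (R : realType) d (X : measurableType d)
    (m : {measure set X -> \bar R}) (g : X -> R) (a : R)
    (K K' : R.-spker X ~> X) (h : X * X -> \bar R) :
  measurable_fun setT g -> (forall x, 0 <= g x) -> 0 <= a ->
  (forall E, measurable E -> joint_fwd m g K E = (a%:E * joint_bwd m g K' E)%E) ->
  measurable_fun setT h -> (forall z, 0 <= h z)%E ->
  (\int[m]_x ((g x)%:E * \int[K x]_y h (x, y)) =
   \int[m]_y ((a * g y)%:E * \int[K' y]_x h (x, y)))%E.
Proof.
move=> mg g0 a0 KK' mh h0.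
have mag : measurable_fun setT (fun y => a * g y) by exact: measurable_funM.
have ag0 y : 0 <= a * g y by exact: mulr_ge0.
apply: (integral_like_unique
  (integral_like_weighted_kernel m K mg g0 (@measurable_id _ _ setT))
  (integral_like_weighted_kernel m K' mag ag0 (@measurable_swap _ _ X X))) => // E mE.
rewrite /= -/(joint_fwd m g K E) KK'// /joint_bwd -ge0_integralZl//; last 2 first.
- apply: emeasurable_funM; first exact/measurable_EFinP.
  apply: (measurable_fun_integral_sfinite_kernel ((EFin \o \1_E) \o @unstable.swap _ _)) => [t/=|].
    by rewrite lee_fin.
  apply: measurableT_comp; last exact: measurable_swap.
  exact/measurable_EFinP.
- by move=> y _; rewrite mule_ge0 ?lee_fin// integral_ge0// => x _; rewrite lee_fin.
by apply: eq_integral => y _; rewrite EFinM muleA.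
Qed.

(** * Kernels given by a density with respect to a kernel *)

Section density_kernel.
Local Open Scope ereal_scope.
Context (R : realType) d d' (X : measurableType d) (Y : measurableType d').
Variables (K : R.-sfker X ~> Y) (w : X * Y -> \bar R).
Hypotheses (mw : measurable_fun setT w) (w0 : forall z, 0 <= w z).

Let mwx x : measurable_fun setT (fun y => w (x, y)).
Proof. exact: measurable_fun_pair2. Qed.

Definition density_kernel x (A : set Y) := \int[K x]_(y in A) w (x, y).

Let density_kernel0 x : density_kernel x set0 = 0.
Proof. exact: integral_set0. Qed.

Let density_kernel_ge0 x A : 0 <= density_kernel x A.
Proof. exact: integral_ge0. Qed.

Let density_kernel_sigma_additive x : semi_sigma_additive (density_kernel x).
Proof.
move=> F mF tF mUF; rewrite /density_kernel ge0_integral_bigcup//; last first.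
  exact: measurable_funTS.
by apply: is_cvg_ereal_nneg_natsum_cond => n _ _; exact: integral_ge0.
Qed.

HB.instance Definition _ x := isMeasure.Build _ _ R (density_kernel x)
  (density_kernel0 x) (density_kernel_ge0 x) (@density_kernel_sigma_additive x).

Definition mdensity_kernel : X -> {measure set Y -> \bar R} := density_kernel.

Let measurable_density_kernel U : measurable U ->
  measurable_fun setT (mdensity_kernel ^~ U).
Proof.
move=> mU; rewrite /mdensity_kernel /= /density_kernel.
under eq_fun do rewrite integral_indicE.
apply: (measurable_fun_integral_sfinite_kernel
  (fun z => (\1_U z.2)%:E * w z)) => [z|].
  by rewrite mule_ge0 ?lee_fin.
apply: emeasurable_funM => //; apply/measurable_EFinP.
exact: measurableT_comp.
Qed.

HB.instance Definition _ := isKernel.Build _ _ _ _ _ mdensity_kernel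
  measurable_density_kernel.

Lemma spker_of_density : (forall x, \int[K x]_y w (x, y) <= 1) ->
  exists Q : R.-spker X ~> Y,
    forall x A, Q x A = \int[K x]_(y in A) w (x, y).
Proof.
move=> w1.
have h : ereal_sup [set mdensity_kernel x setT | x in setT] <= 1.
  by apply/sprob_kernelP.
pose Q' := Kernel_isSubProbability.Build _ _ _ _ R mdensity_kernel h.
pose Q : R.-spker X ~> Y := HB.pack mdensity_kernel Q'.
by exists Q.
Qed.

End density_kernel.

(** * Null sets under the adjoint relation *)

Section adjoint_kernel.
Context (R : realType) d (T : measurableType d).
Variables (L : {measure set T -> \bar R}) (psi : T -> R) (a : R)
  (K Kt : R.-spker T ~> T).
Hypotheses (mpsi : measurable_fun setT psi) (psi0 : forall x, 0 < psi x)
  (a0 : 0 < a)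
  (KKt : forall E, measurable E ->
     joint_fwd L psi K E = (a%:E * joint_bwd L psi Kt E)%E).

Let apsi0 y : 0 < a * psi y. Proof. exact: mulr_gt0. Qed.

Let mapsi : measurable_fun setT (fun y => a * psi y).
Proof. exact: measurable_funM. Qed.

Let mint (h : T * T -> \bar R) : measurable_fun setT h -> (forall z, 0 <= h z)%E ->
  measurable_fun setT (fun y => \int[Kt y]_x h (x, y))%E.
Proof.
move=> mh h0.
apply: (measurable_fun_integral_sfinite_kernel (h \o @unstable.swap _ _)) => [t|].
  exact: h0.
by apply: (measurableT_comp mh); exact: measurable_swap.
Qed.

(** Testing the adjoint relation with the indicator of [A] in the first coordinate gives 0 on the
    forward side, and the backward weight [a * psi y] is positive. The exceptional set of [y]
    depends on [A]. *)
Lemma adjoint_kernel_null A : measurable A -> L A = 0%E ->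
  {ae L, forall y, Kt y A = 0%E}.
Proof.
move=> mA LA.
have mA1 : measurable_fun setT (fun z : T * T => (\1_A z.1)%:E : \bar R).
  by apply/measurable_EFinP; apply: measurableT_comp.
have A10 (z : T * T) : (0 <= (\1_A z.1)%:E :> \bar R)%E by rewrite lee_fin.
have := joint_integral_eq mpsi (fun x => ltW (psi0 x)) (ltW a0) KKt mA1 A10.
rewrite [X in X = _ -> _](_ : _ = 0%E); last first.
  transitivity (\int[L]_(x in A) ((psi x)%:E * K x setT))%E; last first.
    apply: null_set_integral => //; apply: measurable_funTS.
    apply: emeasurable_funM; first exact/measurable_EFinP.
    exact: measurable_kernel.
  rewrite [RHS]integral_indicE; apply: eq_integral => x _ /=.
  by rewrite integral_cst// muleCA.
move=> /esym /ge0_integral0_ae H.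
have : {ae L, forall y, ((a * psi y)%:E * \int[Kt y]_x (\1_A x)%:E)%E = 0%E}.
  apply: H => [|y]; last by rewrite mule_ge0 ?lee_fin ?(ltW (apsi0 _))// integral_ge0.
  apply: emeasurable_funM; first exact/measurable_EFinP.
  exact: (mint mA1).
apply: filterS => y; rewrite integral_indic// setIT => /eqP.
by rewrite mule_eq0 eqe gt_eqF//= => /eqP.
Qed.

(** For an [L]-null [A], a single [y] with all the a.e. properties is enough: there [Kt y A] is 0,
    and the minorization forces [nu' A] to be 0. *)
Lemma minorized_null_dominates (c : R) (nu' : {measure set T -> \bar R}) :
  0 < c -> (0 < L setT)%E ->
  {ae L, forall y, (0 < Kt y setT)%E} ->
  {ae L, forall y, forall A, measurable A ->
     (c%:E * nu' A <= Kt y A / Kt y setT)%E} ->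
  nu' `<< L.
Proof.
move=> c0 LT Kt0 cKt; apply/null_content_dominatesP => A mA LA.
(* Since [L] is nonzero its a.e. filter is proper, so such a [y] exists. *)
have := ae_properfilter_algebraOfSetsType LT => PF.
have [y [[Hy Ky] cy]] := filter_ex (filterI (filterI (adjoint_kernel_null mA LA) Kt0) cKt).
apply/eqP; rewrite eq_le measure_ge0 andbT.
have := cy _ mA; rewrite Hy mul0e.
by rewrite pmule_rle0// lte_fin.
Qed.

(** * The reversed kernel of a quasi-stationary density *)

Variables (pi : probability T R) (f : T -> R) (lam : R).
Hypotheses (pif : is_density L pi f)
  (qsd : forall A, measurable A -> (\int[pi]_x K x A = lam%:E * pi A)%E).

Let mf : measurable_fun setT f. Proof. by case: pif. Qed.
Let f0 x : 0 <= f x. Proof. by case: pif. Qed.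
Let q x := f x / psi x.
Let q0 x : 0 <= q x. Proof. by rewrite divr_ge0// ltW. Qed.
Let mq : measurable_fun setT q.
Proof.
apply: measurable_funM => //.
by apply: measurable_fun_ge0_inv => // x; exact: ltW.
Qed.

(** Since [f = psi * q], integrating against [pi] amounts to integrating against [L] with weight
    [psi] and the extra factor [q x], to which the adjoint relation applies. *)
Lemma adjoint_integral (h : T * T -> \bar R) :
  measurable_fun setT h -> (forall z, 0 <= h z)%E ->
  (\int[pi]_x \int[K x]_y h (x, y) =
   \int[L]_y ((a * psi y)%:E * \int[Kt y]_x ((q x)%:E * h (x, y))))%E.
Proof.
move=> mh h0.
have mqh : measurable_fun setT (fun z : T * T => ((q z.1)%:E * h z)%E).
  apply: emeasurable_funM => //; apply/measurable_EFinP.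
  exact: measurableT_comp.
have qh0 z : (0 <= (q z.1)%:E * h z)%E by rewrite mule_ge0 ?lee_fin.
rewrite -(joint_integral_eq mpsi (fun x => ltW (psi0 x)) (ltW a0) KKt mqh qh0) /=.
rewrite (integral_density pif); last 2 first.
- exact: (measurable_fun_integral_sfinite_kernel h K).
- by move=> x; exact: integral_ge0.
apply: eq_integral => x _; rewrite ge0_integralZl//; last 2 first.
- exact: (measurable_fun_pair2 x mh).
- by rewrite lee_fin.
rewrite muleA -EFinM; congr (_%:E * _)%E.
by rewrite /q mulrC divfK// gt_eqF.
Qed.

(** Both sides are [L]-densities of the second marginal of pi(dx) K(x,dy), the left one by the
    adjoint relation and the right one by quasi-stationarity. They agree a.e. because [lam * f] is
    integrable. *)
Lemma adjoint_marginal_ae :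
  {ae L, forall y, ((a * psi y)%:E * \int[Kt y]_x (q x)%:E = (lam * f y)%:E)%E}.
Proof.
have mq1 : measurable_fun setT (fun z : T * T => (q z.1)%:E : \bar R).
  by apply/measurable_EFinP; exact: measurableT_comp.
have mg : measurable_fun setT (fun y => (a * psi y)%:E * \int[Kt y]_x (q x)%:E)%E.
  apply: emeasurable_funM; first exact/measurable_EFinP.
  by apply: (mint mq1) => z; rewrite lee_fin.
have pifE A : measurable A -> (\int[L]_(x in A) (f x)%:E = pi A)%E.
  by move=> mA; case: pif => _ _ /(_ _ mA).
have fi : L.-integrable setT (EFin \o f).
  apply/integrableP; split; first exact/measurable_EFinP.
  rewrite (eq_integral (fun x => (f x)%:E)); last first.
    by move=> x _; rewrite gee0_abs ?lee_fin.
  by rewrite pifE// probability_setT ltry.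
have fE A : measurable A -> (\int[L]_(x in A) (lam * f x)%:E = lam%:E * pi A)%E.
  move=> mA; rewrite -pifE//; under eq_integral do rewrite EFinM.
  by rewrite integralZl//; exact: integrableS fi.
have : ae_eq L setT (fun y => (lam * f y)%:E : \bar R)
    (fun y => (a * psi y)%:E * \int[Kt y]_x (q x)%:E)%E.
  apply: integral_ae_eq => //.
    apply: (eq_integrable _ (fun x => lam%:E * (f x)%:E)%E) => //.
    exact: integrableZl.
  move=> E _ mE; rewrite fE// -qsd//.
  have mE2 : measurable_fun setT (fun z : T * T => (\1_E z.2)%:E : \bar R).
    by apply/measurable_EFinP; exact: measurableT_comp.
  transitivity (\int[pi]_x \int[K x]_y (\1_E ((x, y).2))%:E)%E.
    by apply: eq_integral => x _; rewrite integral_indic// setIT.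
  rewrite (adjoint_integral mE2)//.
  rewrite [RHS]integral_indicE; apply: eq_integral => y _ /=.
  rewrite ge0_integralZr//.
  - by rewrite muleA muleC.
  - exact/measurable_EFinP.
  - by move=> x _; rewrite lee_fin; exact: q0.
by apply: filterS => y H; rewrite H.
Qed.

Hypotheses (lam0 : 0 < lam) (lam1 : lam <= 1).

(** The constant [c] may depend on [y] and is left unspecified: it cancels in the quotient Rk(y,A) /
    Rk(y,T). *)
Lemma reverse_kernel : exists Rk : R.-spker T ~> T,
  (forall E, measurable E ->
     joint_fwd pi (fun=> 1) K E = joint_bwd pi (fun=> 1) Rk E) /\
  {ae L, forall y, 0 < f y ->
     Rk y setT = lam%:E /\
     exists2 c : R, 0 < c & forall A, measurable A ->
       (Rk y A = c%:E * \int[Kt y]_(x in A) (q x)%:E)%E}.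
Proof.
pose H y := ((a * psi y)%:E * \int[Kt y]_x (q x)%:E)%E.
(* Off [good], a [pi]-null set, the density is cut to 0 so that the total mass is
   at most [lam] everywhere. *)
pose good y := (0 < f y) && (H y == (lam * f y)%:E).
pose g y := if good y then a * psi y / f y else 0.
have mq2 : measurable_fun setT (fun z : T * T => (q z.2)%:E : \bar R).
  by apply/measurable_EFinP; exact: measurableT_comp.
have mH : measurable_fun setT H.
  apply: emeasurable_funM; first exact/measurable_EFinP.
  apply: (@measurable_fun_integral_sfinite_kernel _ _ _ _ _ (fun z => (q z.2)%:E) Kt) => //.
  by move=> z; rewrite lee_fin; exact: q0.
have mgood : measurable_fun setT good.
  apply: measurable_and; first exact: measurable_fun_ltr.
  apply: measurable_fun_eqe => //; apply/measurable_EFinP.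
  exact: measurable_funM.
have mg : measurable_fun setT g.
  apply: measurable_fun_ifT => //; apply: measurable_funM => //.
  exact: measurable_fun_ge0_inv.
have g0 y : 0 <= g y.
  by rewrite /g; case: ifP => // _; rewrite divr_ge0// ltW.
pose w z := ((g z.1)%:E * (q z.2)%:E)%E.
have mw : measurable_fun setT w.
  by apply: emeasurable_funM => //; apply/measurable_EFinP; exact: measurableT_comp.
have w0 z : (0 <= w z)%E by rewrite mule_ge0 ?lee_fin//; exact: q0.
have mqE : measurable_fun setT (EFin \o q) by exact/measurable_EFinP.
have wE y A : measurable A -> (\int[Kt y]_(x in A) w (y, x) =
    (g y)%:E * \int[Kt y]_(x in A) (q x)%:E)%E.
  move=> mA; rewrite -[RHS]ge0_integralZl ?lee_fin//.
    exact: measurable_funTS.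
  by move=> x _; rewrite lee_fin; exact: q0.
have gqE y : good y -> ((g y)%:E * \int[Kt y]_x (q x)%:E = lam%:E)%E.
  move=> gy; rewrite /g gy; case/andP : gy => fy /eqP Hy.
  rewrite mulrC EFinM -muleA -/(H y) Hy -EFinM mulrCA mulVf ?mulr1//.
  by rewrite gt_eqF.
have w1 y : (\int[Kt y]_x w (y, x) <= 1)%E.
  rewrite wE//; have [/gqE ->|/negbTE gy] := boolP (good y).
    by rewrite lee_fin.
  by rewrite /g gy mul0e.
have [Rk RkE] := spker_of_density mw w0 w1.
have aeH := adjoint_marginal_ae.
exists Rk; split => [E mE|]; last first.
  apply: filterS aeH => y Hy fy.
  have gy : good y by rewrite /good fy /H Hy eqxx.
  split; first by rewrite RkE wE// gqE.
  exists (g y); last by move=> A mA; rewrite RkE wE.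
  by rewrite /g gy divr_gt0.
have mE1 : measurable_fun setT (fun z => (\1_E z)%:E : \bar R).
  exact/measurable_EFinP.
have mES : measurable_fun setT (fun z => (\1_E (unstable.swap z))%:E : \bar R).
  by apply/measurable_EFinP; apply: measurableT_comp => //; exact: measurable_swap.
have mS y : measurable [set x | E (x, y)].
  have := measurable_ysection y mE.
  by rewrite /ysection; congr measurable; apply/seteqP; split => x /=; rewrite inE.
have indS y x : \1_E (x, y) = \1_[set x | E (x, y)] x :> R.
  by rewrite !indicE; congr (_%:R); apply/idP/idP; rewrite !inE.
rewrite /joint_fwd /joint_bwd; under eq_integral do rewrite mul1e.
under [RHS]eq_integral do rewrite mul1e.
rewrite (adjoint_integral mE1)//.
rewrite (integral_density pif); last 2 first.
- apply: (@measurable_fun_integral_sfinite_kernel _ _ _ _ _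
    (fun z => (\1_E (unstable.swap z))%:E) Rk) => //.
- by move=> y; apply: integral_ge0 => x _; rewrite lee_fin.
have RkSE y : (\int[Rk y]_x (\1_E (x, y))%:E =
    (g y)%:E * \int[Kt y]_x ((q x)%:E * (\1_E (x, y))%:E))%E.
  under eq_integral do rewrite indS.
  rewrite integral_indic// setIT RkE wE// integral_indicE.
  by congr (_ * _)%E; apply: eq_integral => x _; rewrite indS muleC.
under [RHS]eq_integral do rewrite RkSE.
have mKq : measurable_fun setT
    (fun y => \int[Kt y]_x ((q x)%:E * (\1_E (x, y))%:E))%E.
  apply: (@measurable_fun_integral_sfinite_kernel _ _ _ _ _
    (fun z => (q z.2)%:E * (\1_E (unstable.swap z))%:E)%E Kt) => //.
    by move=> z; rewrite mule_ge0 ?lee_fin//; exact: q0.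
  exact: emeasurable_funM.
have Kq0 y : (0 <= \int[Kt y]_x ((q x)%:E * (\1_E (x, y))%:E))%E.
  by apply: integral_ge0 => x _; rewrite mule_ge0 ?lee_fin//; exact: q0.
apply: ge0_ae_eq_integral => //.
- apply: emeasurable_funM => //; exact/measurable_EFinP.
- apply: emeasurable_funM; first exact/measurable_EFinP.
  apply: emeasurable_funM => //; exact/measurable_EFinP.
- by move=> y _; rewrite mule_ge0 ?lee_fin// ltW.
- by move=> y _; rewrite !mule_ge0 ?lee_fin.
apply: filterS aeH => y Hy _.
(* Where [f y] is 0 the backward side vanishes, and the forward side is at most [H y], equal to
   [lam * f y]. Where [f y] is positive it cancels the denominator of [g y]. *)
have := f0 y; rewrite le_eqVlt => /predU1P[fy|fy].
  rewrite -fy mul0e; apply/eqP; rewrite eq_le; apply/andP; split; last first.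
    by rewrite mule_ge0 ?lee_fin// ltW.
  have Hy0 : H y = 0%E by rewrite /H Hy -fy mulr0.
  rewrite -[leRHS]Hy0 lee_wpmul2l ?lee_fin ?(ltW (apsi0 _))//.
  apply: ge0_le_integral => //.
  - by move=> x _; rewrite mule_ge0 ?lee_fin//; exact: q0.
  - apply: emeasurable_funM => //.
    by apply: (measurable_fun_pair1 y mE1).
  - by move=> x _; rewrite -EFinM lee_fin ler_piMr.
have gy : good y by rewrite /good fy /H Hy eqxx.
rewrite muleA -EFinM /g gy mulrCA divff ?mulr1// gt_eqF//.
Qed.

(** With [p] the mass of [Kt y], the numerator satisfies c p nu'(f 1_A) <= Kt(y, f 1_A) <= s Kt(y, q
    1_A) and the denominator Kt(y, q) <= s' M p. The mass [p] cancels, which leaves the constant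
    [c / (s * s' * M)]. *)
Lemma reverse_kernel_ratio_ge (c M s s' : R) (nu' : probability T R) (Rk : R.-spker T ~> T) :
  0 < c -> {ae L, forall y, f y <= M} -> 0 < M -> 0 < s -> 0 < s' ->
  (forall x, psi x <= s) -> (forall x, (psi x)^-1 <= s') ->
  {ae L, forall y, (0 < Kt y setT)%E} ->
  {ae L, forall y, forall A, measurable A ->
     (c%:E * nu' A <= Kt y A / Kt y setT)%E} ->
  {ae L, forall y, 0 < f y ->
     Rk y setT = lam%:E /\
     exists2 c : R, 0 < c & forall A, measurable A ->
       (Rk y A = c%:E * \int[Kt y]_(x in A) (q x)%:E)%E} ->
  {ae L, forall y, 0 < f y -> (0 < Rk y setT)%E /\ forall A, measurable A ->
     ((c / (s * s' * M))%:E * \int[nu']_(x in A) (f x)%:E <= Rk y A / Rk y setT)%E}.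
Proof.
move=> c0 fM M0 s0 s'0 psis psis' Kt0 cKt RkE.
have mB : measurable [set x | M < f x].
  rewrite -[X in measurable X]setTI -[X in _ `&` X]/(f @^-1` [set x | M < x]).
  by apply: mf => //; rewrite -set_itvoy; exact: measurable_itv.
have LB : L [set x | M < f x] = 0%E.
  case: fM => N [mN N0 fN]; apply: (subset_measure0 _ mN _ N0) => // x /= Mx.
  by apply: fN => /=; apply/negP; rewrite -ltNge.
have KB : {ae L, forall y, Kt y [set x | M < f x] = 0%E /\ (0 < Kt y setT)%E}.
  by apply: filterS2 (adjoint_kernel_null mB LB) Kt0 => y.
apply: filterS3 KB cKt RkE => y [KB K0] cK Rky fy.
have [RkT [k k0 RkA]] := Rky fy.
rewrite RkT; split=> [|A mA]; first by rewrite lte_fin.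
have mfE : measurable_fun setT (EFin \o f) by exact/measurable_EFinP.
have mqE : measurable_fun setT (EFin \o q) by exact/measurable_EFinP.
have fE0 x : (0 <= (EFin \o f) x)%E by rewrite lee_fin.
have qE0 x : (0 <= (EFin \o q) x)%E by rewrite lee_fin; exact: q0.
have pfin : Kt y setT \is a fin_num.
  by rewrite ge0_fin_numE// (le_lt_trans (sprob_kernel_le1 Kt y))// ltry.
set p := fine (Kt y setT); have pE : Kt y setT = p%:E by rewrite fineK.
have p0 : 0 < p by rewrite -lte_fin -pE.
have NT : (k%:E * \int[Kt y]_x (q x)%:E = lam%:E)%E by rewrite -RkA.
have NTle : (\int[Kt y]_x (q x)%:E <= (s' * M * p)%:E)%E.
  rewrite EFinM -pE -integral_cst//.
  apply: ae_ge0_le_integral => //.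
  - by move=> x _; exact: qE0.
  - by move=> x _; rewrite lee_fin mulr_ge0// ltW.
  (* The bound of [q] by [s' * M] can fail only where [f] exceeds [M], a set that [Kt y] does not
     charge. *)
  - exists [set x | M < f x]; split => // x /= /not_implyP[_] /negP.
    rewrite lee_fin -ltNge; apply: contraPP => /negP; rewrite -leNgt => fxM.
    apply/negP; rewrite -leNgt mulrC ler_pM//.
    by rewrite invr_ge0 ltW.
have NAT : (\int[Kt y]_(x in A) (q x)%:E <= \int[Kt y]_x (q x)%:E)%E.
  by apply: ge0_subset_integral => // x _; exact: qE0.
have NAle : (\int[Kt y]_(x in A) (f x)%:E <= s%:E * \int[Kt y]_(x in A) (q x)%:E)%E.
  rewrite -ge0_integralZl//; last 3 first.
  - exact: measurable_funTS.
  - by move=> x _; exact: qE0.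
  - by rewrite lee_fin ltW.
  apply: ge0_le_integral => //.
  - by move=> x _; exact: fE0.
  - exact: measurable_funTS.
  - by apply: measurable_funTS; exact: measurable_funeM.
  - move=> x _; rewrite -EFinM lee_fin /q mulrC -mulrA ler_peMr//.
    by rewrite mulrC ler_pdivlMr ?mul1r.
(* The minorization is read as an inequality between the measures [nu'] scaled by [c * p] and
   [Kt y], then integrated. *)
have nuA : ((c * p)%:E * \int[nu']_(x in A) (f x)%:E <= \int[Kt y]_(x in A) (f x)%:E)%E.
  have cp0 : 0 <= c * p by rewrite mulr_ge0// ltW.
  rewrite -[(c * p)%:E]/((NngNum cp0)%:num%:E) -ge0_integral_mscale//; last 2 first.
  - exact: measurable_funTS.
  - by move=> x _; exact: fE0.
  apply: (ge0_le_measure_integral _ mA fE0 mfE) => S mS /=.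
  have := cK _ mS; rewrite pE inver gt_eqF// lee_pdivlMr//.
  by rewrite /mscale/= EFinM muleAC.
have NT0 : (0 <= \int[Kt y]_x (q x)%:E)%E by apply: integral_ge0 => x _; exact: qE0.
have NA0 : (0 <= \int[Kt y]_(x in A) (q x)%:E)%E by apply: integral_ge0 => x _; exact: qE0.
have n0 : (0 <= \int[nu']_(x in A) (f x)%:E)%E by apply: integral_ge0 => x _; exact: fE0.
have NTfin : (\int[Kt y]_x (q x)%:E)%E \is a fin_num.
  by rewrite ge0_fin_numE// (le_lt_trans NTle)// ltry.
have NAfin : (\int[Kt y]_(x in A) (q x)%:E)%E \is a fin_num.
  by rewrite ge0_fin_numE// (le_lt_trans NAT)// -ge0_fin_numE.
(* Finiteness comes from the bound itself, since [c * p] is positive. *)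
have nfin : (\int[nu']_(x in A) (f x)%:E)%E \is a fin_num.
  rewrite ge0_fin_numE//.
  have := le_trans nuA NAle; rewrite -lee_pdivlMl ?mulr_gt0// => /le_lt_trans; apply.
  by rewrite -(fineK NAfin) -!EFinM ltry.
rewrite RkA//; have := le_trans nuA NAle; move: NT NTle n0.
rewrite inver gt_eqF// -(fineK NTfin) -(fineK NAfin) -(fineK nfin) -!EFinM !lee_fin.
move: (fine _) => t; move: (fine _) => n; move: (fine _) => u [ltE] tle n0 nle.
(* Writing [lam] as [k * t] cancels [k] and leaves [t * (c / (s * s' * M) * n) <= u]. *)
rewrite [leRHS]mulrC ler_pdivlMl// -ltE -[leLHS]mulrA ler_pM2l//.
apply: (@le_trans _ _ (s' * M * p * (c / (s * s' * M) * n))).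
  by rewrite ler_wpM2r// mulr_ge0// ltW// divr_gt0// !mulr_gt0.
rewrite -(ler_pM2l s0); apply: le_trans nle.
rewrite le_eqVlt; apply/orP; left; apply/eqP; field.
by rewrite !gt_eqF.
Qed.

End adjoint_kernel.

(** * Bounds on [psi], the eigenvalue of [pi], and absolute continuity *)

Lemma Bb_pos_gt0 (R : realType) d (T : measurableType d) (psi : T -> R) x :
  Bb_pos psi -> 0 < psi x.
Proof. by move=> [_ _ [m m0 mp]]; exact: lt_le_trans (mp x). Qed.

Lemma supnorm_ge (R : realType) (T : Type) (g : T -> R) (M : R) x :
  (forall x, 0 <= g x) -> (forall x, g x <= M) -> g x <= supnorm g.
Proof.
move=> g0 gM; rewrite /supnorm; apply: ub_le_sup.
  by exists M => _ [y _ <-]; rewrite ger0_norm.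
by exists x => //; rewrite ger0_norm.
Qed.

(** The eigenvalue [lam] is the survival probability at time [t] started from [pi], at most 1
    because the kernel is submarkovian. *)
Lemma QSD_eigen (R : realType) d (T : measurableType d) (Tm : set R)
    (P : R -> R.-spker T ~> T) (pi : probability T R) (t : R) :
  is_QSD Tm P pi -> Tm t -> exists lam : R, [/\ 0 < lam, lam <= 1 &
    forall A, measurable A -> (\int[pi]_x P t x A = lam%:E * pi A)%E].
Proof.
move=> qsd /qsd [I0 IA].
have I1 : (\int[pi]_x P t x setT <= 1)%E.
  apply: (@le_trans _ _ (\int[pi]_x cst 1 x)%E); last first.
    by rewrite integral_cst// mul1e probability_le1.
  apply: ge0_le_integral => //; first exact: measurable_kernel.
  by move=> x _; exact: sprob_kernel_le1.
have Ifin : (\int[pi]_x P t x setT)%E \is a fin_num.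
  by rewrite ge0_fin_numE ?(ltW I0)// (le_lt_trans I1)// ltry.
exists (fine (\int[pi]_x P t x setT)%E); move: I0 I1 IA.
rewrite -(fineK Ifin) lte_fin lee_fin; move: (fine _) => lam lam0 lam1 IA.
split => // A /IA <-.
by rewrite inver gt_eqF// muleCA -EFinM divff ?gt_eqF// mule1.
Qed.

Lemma density_null_dominates (R : realType) d (T : measurableType d)
    (L p : {measure set T -> \bar R}) (f : T -> R) :
  is_density L p f -> p `<< L.
Proof.
move=> [mf f0 pf]; apply/null_content_dominatesP => A mA LA.
rewrite pf// null_set_integral//; apply: measurable_funTS.
exact/measurable_EFinP.
Qed.

(** * Assembly of the reverse Dobrushin condition *)

Unset Implicit Arguments. Set Strict Implicit. Set Printing Implicit Defensive.

Theorem mainTheorem6 (R : realType) (d : measure_display) (T : measurableType d)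
  (dist : T -> T -> R) (L : {measure set T -> \bar R})
  (Tm : set R) (P : R -> R.-spker T ~> T) (pi : probability T R)
  (f : T -> R)
  (psi : T -> R) (t0 a c0' : R) (Pt : R.-spker T ~> T) (nu' : probability T R) :
  (* standing assumptions *)
  is_metric dist -> borel_for dist -> sigma_finite setT L ->
  full_support dist L ->
  (Tm = [set t | 0 <= t] \/ Tm = [set n%:R | n in [set: nat]]) ->
  (* pi is a QSD in P_infty(Lambda), with f a version of d pi / d Lambda *)
  is_QSD Tm P pi ->
  is_density L pi f -> (ess_sup L (fun x => (f x)%:E) < +oo)%E ->
  (* (AD) *)
  Bb_pos psi -> Tm t0 -> 0 < t0 -> 0 < a ->
  (forall E, measurable E ->
     joint_fwd L psi (P t0) E = (a%:E * joint_bwd L psi Pt E)%E) ->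
  {ae L, forall y, (0 < Pt y setT)%E} ->
  0 < c0' ->
  {ae L, forall y, forall A, measurable A ->
     (c0'%:E * nu' A <= Pt y A / Pt y setT)%E} ->
  ~ mutually_singular nu' pi ->
  (* conclusions *)
  let nuf := (\int[nu']_x (f x)%:E)%E in
  let c0 := ((c0'%:E * nuf) /
      ((supnorm psi * supnorm (fun x => (psi x)^-1))%:E *
       ess_sup L (fun x => (f x)%:E)))%E in
  let nu := fun A => ((\int[nu']_(x in A) (f x)%:E) / nuf)%E in
  [/\ nu' `<< L, (0 < nuf)%E, (0 < c0)%E, (c0 <= 1)%E &
      exists Rk : R.-spker T ~> T,
        (forall E, measurable E ->
           joint_fwd pi (fun=> 1) (P t0) E = joint_bwd pi (fun=> 1) Rk E) /\
        {ae pi, forall y, (0 < Rk y setT)%E /\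
           forall A, measurable A -> (c0 * nu A <= Rk y A / Rk y setT)%E}].
Proof.
move=> _ _ _ _ _ qsd pif fM Bpsi Tt0 _ a0 KKt Kt0 c0 cKt nsing nuf c0E nu.
have mpsi : measurable_fun setT psi by case: Bpsi.
have psi0 x : 0 < psi x by exact: Bb_pos_gt0.
have [mf f0 pfE] := pif.
have mfE : measurable_fun setT (EFin \o f) by exact/measurable_EFinP.
have piL := density_null_dominates pif.
have LT : (0 < L setT)%E.
  rewrite lt0e measure_ge0 andbT; apply/eqP => L0.
  have : pi setT = 0%E by move/null_content_dominatesP: piL; exact.
  by rewrite probability_setT => /eqP; rewrite onee_eq0.
set eM := ess_sup L (fun x => (f x)%:E) in fM c0E *.
have fleM : {ae L, forall x, ((f x)%:E <= eM)%E} by exact: ess_sup_ge.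
have eM0 : (0 <= eM)%E.
  by apply: ess_sup_gee => //; apply: nearW => x; rewrite lee_fin.
have eMfin : eM \is a fin_num by rewrite ge0_fin_numE.
set M := fine eM; have eME : eM = M%:E by rewrite fineK.
have fM' : {ae L, forall x, f x <= M}.
  by apply: filterS fleM => x; rewrite eME lee_fin.
(* If [M] were 0, the density would vanish a.e. and [pi] would have mass 0. *)
have M0 : 0 < M.
  rewrite lt_def -lee_fin -eME eM0 andbT; apply/eqP => M0.
  have : (pi setT <= 0)%E.
    rewrite pfE// -[leRHS](integral0 L setT).
    apply: ae_ge0_le_integral => //; first by move=> x _; rewrite lee_fin.
    by apply: filterS fM' => x; rewrite M0 /= lee_fin.
  by rewrite probability_setT leNgt lte01.
have nu'L : nu' `<< L.
  exact: (minorized_null_dominates mpsi psi0 a0 KKt c0 LT Kt0 cKt).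
have nufM : (nuf <= M%:E)%E.
  apply: (@le_trans _ _ (\int[nu']_x (cst M%:E) x)%E); last first.
    by rewrite integral_cst// -[leRHS]mule1 lee_wpmul2l ?lee_fin ?(ltW M0)// probability_le1.
  apply: ae_ge0_le_integral => //.
  - by move=> x _; rewrite lee_fin.
  - by move=> x _; rewrite lee_fin ltW.
  - by apply: filterS (null_dominates_ae nu'L fM') => x; rewrite lee_fin.
have nuf_ge0 : (0 <= nuf)%E by apply: integral_ge0 => x _; rewrite lee_fin.
(* If nu'(f) were 0, the set where [f] is positive would be [nu']-null and its complement [pi]-null,
   making the two measures mutually singular. *)
have nuf0 : (0 < nuf)%E.
  rewrite lt0e nuf_ge0 andbT; apply/eqP => nuf0; apply: nsing.
  have mA : measurable [set x | 0 < f x].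
    rewrite -[X in measurable X]setTI -[X in _ `&` X]/(f @^-1` [set x | 0 < x]).
    by apply: mf => //; rewrite -set_itvoy; exact: measurable_itv.
  exists [set x | 0 < f x]; split => //.
    have [N [mN N0 fN]] := ge0_integral0_ae mfE (fun x => f0 x) nuf0.
    apply: (subset_measure0 _ mN _ N0) => // x /= fx.
    by apply: fN => /= -[] fx0; rewrite fx0 ltxx in fx.
  rewrite pfE; last exact: measurableC.
  apply: integral0_eq => x /= /negP; rewrite -leNgt => fx.
  by congr (_%:E); apply/eqP; rewrite eq_le fx f0.
have nuffin : nuf \is a fin_num.
  by rewrite ge0_fin_numE// (le_lt_trans nufM)// ltry.
set n := fine nuf; have nE : nuf = n%:E by rewrite fineK.
have n0 : 0 < n by rewrite -lte_fin -nE.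
have nM : n <= M by rewrite -lee_fin -nE.
set s := supnorm psi; set s' := supnorm (fun x => (psi x)^-1).
have psis x : psi x <= s.
  case: Bpsi => _ [B psiB] _; apply: (@supnorm_ge _ _ psi B) => // y; exact: ltW.
have psis' x : (psi x)^-1 <= s'.
  case: Bpsi => _ _ [m m0 mpsi'].
  apply: (@supnorm_ge _ _ (fun x => (psi x)^-1) m^-1) => y.
    by rewrite invr_ge0 ltW.
  by rewrite lef_pV2// posrE.
have s0 : 0 < s by exact: lt_le_trans (psi0 point) (psis point).
have s'0 : 0 < s'.
  by apply: lt_le_trans (psis' point); rewrite invr_gt0.
have ss'1 : 1 <= s * s'.
  rewrite -(@divff _ (psi point)) ?gt_eqF//.
  by apply: ler_pM => //; [exact: ltW|rewrite invr_ge0 ltW].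
(* The minorization is taken on the whole space at one good [y]. *)
have c1 : c0' <= 1.
  have PF := ae_properfilter_algebraOfSetsType LT.
  have [y [K0 /(_ _ measurableT)]] := filter_ex (filterI Kt0 cKt).
  rewrite probability_setT mule1 divee ?gt_eqF//.
  by rewrite ge0_fin_numE ?ltW// (le_lt_trans (sprob_kernel_le1 Pt y))// ltry.
have ssM0 : 0 < s * s' * M by rewrite !mulr_gt0.
have c0EE : c0E = (c0' * n / (s * s' * M))%:E.
  by rewrite /c0E nE eME -!EFinM inver gt_eqF.
rewrite c0EE; split => //.
- by rewrite lte_fin divr_gt0// mulr_gt0.
(* The bound by 1 combines [c0' <= 1 <= s * s'] with [n <= M]. *)
- rewrite lee_fin ler_pdivrMr// mul1r ler_pM ?(ltW c0) ?(ltW n0)//.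
  exact: le_trans c1 ss'1.
have [lam [lam0 lam1 lamE]] := QSD_eigen qsd Tt0.
have [Rk [RkJ RkE]] := reverse_kernel mpsi psi0 a0 KKt pif lamE lam1.
exists Rk; split => //.
have f_gt0 : {ae pi, forall y, 0 < f y}.
  exists [set y | f y <= 0]; split.
  - rewrite -[X in measurable X]setTI -[X in _ `&` X]/(f @^-1` [set x | x <= 0]).
    by apply: mf => //; rewrite -set_itvNyc; exact: measurable_itv.
  - rewrite pfE; last first.
      rewrite -[X in measurable X]setTI -[X in _ `&` X]/(f @^-1` [set x | x <= 0]).
      by apply: mf => //; rewrite -set_itvNyc; exact: measurable_itv.
    apply: integral0_eq => x /= fx.
    by congr (_%:E); apply/eqP; rewrite eq_le fx f0.
  - by move=> x /= /negP; rewrite -leNgt.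
have H := reverse_kernel_ratio_ge mpsi psi0 a0 KKt pif lam0 c0 fM' M0 s0 s'0
  psis psis' Kt0 cKt RkE.
apply: filterS2 (null_dominates_ae piL H) f_gt0 => y /[apply] -[Rk0 RkA].
split => // A mA; apply: le_trans (RkA _ mA).
(* The factor [n] in the constant cancels the normalization of [nu]. *)
rewrite /nu nE inver gt_eqF// muleCA -EFinM muleC.
by rewrite (_ : _ * n^-1 = c0' / (s * s' * M))//; field; rewrite !gt_eqF.
Qed.
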